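(* Let $A\in\mathbb{R}^{n\times n}$ be an irreducible singular lower Hessenberg M-matrix of the form $A=I-T$ with $T$ column stochastic (so that $\mathbf{e}^TA=\mathbf{0}^T$, where $\mathbf{e}$ is the vector of all ones). Let $A_{n-1}=A[1\colon n-1,1\colon n-1]$ be its leading principal $(n-1)\times(n-1)$ submatrix, let $L=\begin{bmatrix} I_{n-1} & \mathbf{0}\\ \mathbf{e}^T & 1\end{bmatrix}$, and define \[ M'_J=L^{-1}\begin{bmatrix}\operatorname{diag}(A_{n-1}) & 0\\ 0^T & 1\end{bmatrix},\quad M'_{GS}=L^{-1}\begin{bmatrix}\operatorname{tril}(A_{n-1}) & 0\\ 0^T & 1\end{bmatrix}, \] \[ M'_{AGS}=L^{-1}\begin{bmatrix}\operatorname{triu}(A_{n-1}) & 0\\ 0^T & 1\end{bmatrix},\quad M'_{S}=L^{-1}\begin{bmatrix}\mathcal{S}(A_{n-1}) & 0\\ 0^T & 1\end{bmatrix}, \] where $\mathcal{S}(A_{n-1})$ is the stair matrix of first order or of second order generated by $A_{n-1}$, and set $N'_X=M'_X-A$ for $X\in\{J,GS,AGS,S\}$. Then \[ \gamma({M'_J}^{-1}N'_J)\geq \gamma({M'_{GS}}^{-1}N'_{GS})\geq \gamma({M'_S}^{-1}N'_S)\geq \gamma({M'_{AGS}}^{-1}N'_{AGS}). \]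
   Context: For a square matrix $P$ with spectrum $\sigma(P)$, $\gamma(P)=\max\{|\lambda| : \lambda\in\sigma(P),\ \lambda\neq 1\}$. $A$ is lower Hessenberg if $A_{ij}=0$ whenever $j>i+1$. $\operatorname{diag}(B)$ is the diagonal part of $B$; $\operatorname{tril}(B)$ (resp. $\operatorname{triu}(B)$) is the lower (resp. upper) triangular part of $B$ including the diagonal. For a square matrix $B$ of size $m$, let $\operatorname{tridiag}(B)$ keep the subdiagonal, diagonal and superdiagonal entries of $B$ and zero the rest; the stair matrix of first order generated by $B$ is obtained from $\operatorname{tridiag}(B)$ by setting entries $(i,i-1)$ and $(i,i+1)$ (when they exist) to zero for every odd $i$, and the stair matrix of second order by doing so for every even $i$. *)

(* Defs.v *)
From mathcomp Require Import all_boot all_algebra.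
From mathcomp Require Import reals.
From mathcomp.real_closed Require Import complex.

Set Implicit Arguments.
Unset Strict Implicit.
Unset Printing Implicit Defensive.

Import GRing.Theory Num.Theory.
Local Open Scope ring_scope.

Section Defs.
Variable R : realType.

(* Eigenvalues (with multiplicity) of a real square matrix: the complex roots
   of its characteristic polynomial, i.e. the spectrum sigma(P). *)
Definition spectrum_seq n (P : 'M[R]_n) : seq R[i] :=
  sval (closed_field_poly_normal (char_poly (map_mx (real_complex R) P))).

Definition gamma n (P : 'M[R]_n) : R :=
  \big[Num.max/0]_(z <- spectrum_seq P | z != 1) Normc.normc z.

Definition lower_hessenberg n (A : 'M[R]_n) : Prop :=
  forall i j : 'I_n, (i.+1 < j)%N -> A i j = 0.

Definition column_stochastic n (T : 'M[R]_n) : Prop :=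
  (forall i j, 0 <= T i j) /\ (forall j, \sum_i T i j = 1).

Definition irreducible_mx n (A : 'M[R]_n) : Prop :=
  forall i j : 'I_n, connect (fun k l => A k l != 0) i j.

Definition spectral_radius n (B : 'M[R]_n) : R :=
  \big[Num.max/0]_(z <- spectrum_seq B) Normc.normc z.

Definition M_matrix n (A : 'M[R]_n) : Prop :=
  exists (s : R) (B : 'M[R]_n),
    (forall i j, 0 <= B i j) /\ spectral_radius B <= s /\ A = s%:M - B.

Definition lead_sub m (A : 'M[R]_m.+1) : 'M[R]_m :=
  \matrix_(i < m, j < m) A (widen_ord (leqnSn m) i) (widen_ord (leqnSn m) j).

Definition ext1 m (B : 'M[R]_m) : 'M[R]_m.+1 :=
  \matrix_(i, j)
    match unlift ord_max i, unlift ord_max j with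
    | Some i', Some j' => B i' j'
    | None, None => 1
    | _, _ => 0
    end.

Definition Lmx m : 'M[R]_m.+1 :=
  \matrix_(i, j) (if (i == j) || (i == ord_max) then 1 else 0).

Definition diag_part m (B : 'M[R]_m) : 'M[R]_m :=
  \matrix_(i, j) (if i == j then B i j else 0).
Definition tril_part m (B : 'M[R]_m) : 'M[R]_m :=
  \matrix_(i, j) (if (j <= i)%N then B i j else 0).
Definition triu_part m (B : 'M[R]_m) : 'M[R]_m :=
  \matrix_(i, j) (if (i <= j)%N then B i j else 0).

(* stair matrix generated by B.  With 1-based row index r = i+1:
   first order  (first = true):  rows with r odd keep only the diagonal;
   second order (first = false): rows with r even keep only the diagonal;
   the other rows keep sub-, main and super-diagonal entries. *)
Definition stair (first : bool) m (B : 'M[R]_m) : 'M[R]_m :=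
  \matrix_(i, j)
    (if i == j then B i j
     else if (odd i == first) && ((j == i.+1 :> nat) || (i == j.+1 :> nat))
          then B i j else 0).

Definition Mprime m (X : 'M[R]_m -> 'M[R]_m) (A : 'M[R]_m.+1) : 'M[R]_m.+1 :=
  invmx (Lmx m) *m ext1 (X (lead_sub A)).

Definition iter_mx m (X : 'M[R]_m -> 'M[R]_m) (A : 'M[R]_m.+1) : 'M[R]_m.+1 :=
  invmx (Mprime X A) *m (Mprime X A - A).

End Defs.

Arguments Lmx {R} m.

(* Main.v *)
(** The matrix [L A] has the rows of [A] on top and a zero last row, so the
    iteration matrix of a splitting has, besides [1], the eigenvalues of
    [I - X^-1 B], where [B] is the leading submatrix of [A] and [X] its diagonal,
    triangular or stair part. These are the [z] at which the pencil
    [z X - (X - B)] is singular. For [0 < l <= 1] the entries of this pencil are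
    [B i j * l ^ x i j] with [x i j] in [{0, 1}], a Z-matrix; going down from
    [l = 1], where it is the nonsingular M-matrix [B], it stays an M-matrix (that
    is, maps some positive vector to a positive vector) exactly as long as [l]
    exceeds all moduli of eigenvalues other than [1]. Since [B] is lower
    Hessenberg, a diagonal scaling [l ^- f j], for a suitable counting function [f],
    makes the pencil of each splitting entrywise comparable with that of the
    next one, so it stays an M-matrix at least as long. *)

Require Import Defs.
From mathcomp Require Import all_boot all_order all_algebra.
From mathcomp Require Import boolp classical_sets reals.
From mathcomp.real_closed Require Import polyrcf complex.
From mathcomp Require Import zify ring lra.

Set Implicit Arguments.
Unset Strict Implicit.
Unset Printing Implicit Defensive.

Import Order.TTheory GRing.Theory Num.Theory.
Local Open Scope ring_scope.

(** * Column kernels and column eigenvectors *)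

Section ColumnKernel.
Variable F : fieldType.

Lemma unitmx_col n (C : 'M[F]_n) :
  (forall w : 'cV_n, C *m w = 0 -> w = 0) -> C \in unitmx.
Proof.
move=> kerC; rewrite -unitmx_tr unitmxE unitfE; apply/det0P => -[v v0 vC].
move/eqP: v0; apply; apply/trmx_inj; rewrite trmx0; apply: kerC.
by rewrite -(trmxK C) -trmx_mul vC trmx0.
Qed.

Lemma eigenvalue_colP n (P : 'M[F]_n) a :
  reflect (exists2 w : 'cV_n, P *m w = a *: w & w != 0)
    (root (char_poly P) a).
Proof.
have -> : char_poly P = char_poly P^T.
  rewrite -[LHS]det_tr; congr (\det _); apply/matrixP => i j.
  by rewrite !mxE eq_sym.
rewrite -eigenvalue_root_char; apply: (iffP eigenvalueP) => -[v vP v0].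
  by exists v^T; rewrite ?trmx_eq0 // -[P]trmxK -trmx_mul vP linearZ.
by exists v^T; rewrite ?trmx_eq0 // -trmx_mul vP linearZ.
Qed.

End ColumnKernel.

(** * M-matrices among Z-matrices *)

Section Zmatrices.
Variable R : realFieldType.

Definition Zmatrix n (C : 'M[R]_n) := forall i j, i != j -> C i j <= 0.

Definition semipositive n (C : 'M[R]_n) :=
  exists2 v : 'cV[R]_n, (forall i, 0 < v i 0) & (forall i, 0 < (C *m v) i 0).

(* Compare [x] with the largest multiple of the positive vector below it. *)
Lemma Zmatrix_monotone n (C : 'M[R]_n) (x : 'cV_n) :
  Zmatrix C -> semipositive C ->
  (forall i, 0 <= (C *m x) i 0) -> forall i, 0 <= x i 0.
Proof.
move=> ZC [v v0 Cv0] Cx0 i0.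
case: (@arg_minP _ _ _ i0 predT (fun i => x i 0 / v i 0)) => // i _ imin.
set t := x i 0 / v i 0 in imin.
have xi : x i 0 = t * v i 0 by rewrite /t divfK // gt_eqF.
have xt j : t * v j 0 <= x j 0 by rewrite -ler_pdivlMr ?imin.
have [t0|t0] := leP 0 t.
  by apply: le_trans (xt i0); rewrite mulr_ge0 // ltW.
(* At [i] the vector [x - t *: v] vanishes, elsewhere it is nonnegative, so row [i] of the Z-matrix
   sends it to a value at most 0; with [t < 0] this makes [(C *m x) i 0] negative. *)
have : (C *m (x - t *: v)) i 0 <= 0.
  rewrite mxE; apply: sumr_le0 => j _; have [<-|nij] := eqVneq i j.
    by rewrite !mxE xi subrr mulr0.
  by rewrite mulr_le0_ge0 ?ZC // !mxE subr_ge0.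
have tC : t * (C *m v) i 0 < 0 by rewrite nmulr_rlt0.
rewrite mulmxBr -scalemxAr mxE [X in _ + X]mxE [X in _ - X]mxE => xC.
by have := Cx0 i; lra.
Qed.

Lemma Zmatrix_kernel n (C : 'M[R]_n) (x : 'cV_n) :
  Zmatrix C -> semipositive C -> C *m x = 0 -> x = 0.
Proof.
move=> ZC sC Cx0; apply/colP => i; rewrite mxE.
have x0 : 0 <= x i 0 by apply: (Zmatrix_monotone ZC sC) => j; rewrite Cx0 mxE.
have : 0 <= (- x) i 0.
  by apply: (Zmatrix_monotone ZC sC) => j; rewrite mulmxN Cx0 oppr0 mxE.
by rewrite mxE => x1; lra.
Qed.

Lemma Zmatrix_unit n (C : 'M[R]_n) :
  Zmatrix C -> semipositive C -> C \in unitmx.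
Proof. by move=> ZC sC; apply: unitmx_col => w; apply: Zmatrix_kernel. Qed.

Lemma Zmatrix_inv_ge0 n (C : 'M[R]_n) i j :
  Zmatrix C -> semipositive C -> 0 <= invmx C i j.
Proof.
move=> ZC sC; have := @Zmatrix_monotone _ _ (col j (invmx C)) ZC sC _ i.
rewrite !mxE; apply=> k.
by rewrite colE mulmxA mulmxV ?Zmatrix_unit // mul1mx mxE ler0n.
Qed.

(** The witness is the vector of row sums of the inverse. A zero entry of it would make the matching
    row of [C *m v] nonpositive, whereas [C *m v] is constantly 1. *)
Lemma Zmatrix_inv_semipositive n (C : 'M[R]_n) :
  Zmatrix C -> C \in unitmx -> (forall i j, 0 <= invmx C i j) ->
  semipositive C.
Proof.
move=> ZC uC iC; pose v : 'cV[R]_n := invmx C *m const_mx 1.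
have Cv : C *m v = const_mx 1 by rewrite mulmxA mulmxV // mul1mx.
have v0 i : 0 <= v i 0.
  by rewrite mxE sumr_ge0 // => j _; rewrite !mxE mulr1.
exists v => i; last by rewrite Cv mxE ltr01.
rewrite lt_def v0 andbT; apply/eqP => vi0.
have : (C *m v) i 0 <= 0; last by rewrite Cv mxE ler10.
rewrite mxE sumr_le0 // => j _; have [<-|nij] := eqVneq i j.
  by rewrite vi0 mulr0.
by rewrite mulr_le0_ge0 // ZC.
Qed.

Lemma semipositive_le n (C D : 'M[R]_n) :
  (forall i j, C i j <= D i j) -> semipositive C -> semipositive D.
Proof.
move=> CD [v v0 Cv]; exists v => // i; apply: lt_le_trans (Cv i) _.
by rewrite !mxE ler_sum // => j _; rewrite ler_wpM2r // ltW.
Qed.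

End Zmatrices.

(** * Limits of nonnegative inverses *)

Section Limit.
Variable R : rcfType.

Lemma horner0_ge0 (p : {poly R}) e :
  0 < e -> (forall t, 0 < t <= e -> 0 <= p.[t]) -> 0 <= p.[0].
Proof.
move=> e0 p0; rewrite leNgt; apply/negP => pn.
have [d d0 pd] : exists2 d, 0 < d &
    forall y, `|y - 0| < d -> `|p.[y] - p.[0]| < - p.[0].
  by apply: poly_cont; rewrite oppr_gt0.
pose t := Num.min e (d / 2).
have t0 : 0 < t by rewrite lt_min e0 divr_gt0.
have te : t <= e by rewrite ge_min lexx.
have td : t <= d / 2 by rewrite ge_min lexx orbT.
have := p0 t; rewrite t0 te => /(_ isT) pt.
have := pd t; rewrite subr0 gtr0_norm // ltr_norml => /(_ _)/andP[]; first lra.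
by move=> _ ?; lra.
Qed.

(* By Cramer's rule an entry of the inverse times the square of the determinant
   is a polynomial in [t]. *)
Lemma inv_ge0_lim n (C X : 'M[R]_n) e :
  0 < e -> C \in unitmx ->
  (forall t, 0 < t <= e ->
     C + t *: X \in unitmx /\ forall i j, 0 <= invmx (C + t *: X) i j) ->
  forall i j, 0 <= invmx C i j.
Proof.
move=> e0 uC Ct i j.
pose P : 'M[{poly R}]_n := map_mx polyC C + 'X *: map_mx polyC X.
have Pt t : map_mx (horner_eval t) P = C + t *: X.
  by apply/matrixP => k l; rewrite !mxE /horner_eval !hornerE.
have pE t : (\adj P i j * \det P).[t] =
    \adj (C + t *: X) i j * \det (C + t *: X).
  by rewrite -Pt -map_mx_adj det_map_mx [map_mx _ _ _ _]mxE hornerM.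
have pE' t : C + t *: X \in unitmx -> (\adj P i j * \det P).[t] =
    invmx (C + t *: X) i j * \det (C + t *: X) ^+ 2.
  move=> ut; rewrite pE /invmx ut [X in _ = X * _]mxE.
  have : \det (C + t *: X) != 0 by rewrite -unitfE -unitmxE.
  by move: (\det _) (\adj _ _ _) => d a d0; field.
have C0 : C = C + 0 *: X by rewrite scale0r addr0.
have d0 : 0 < \det C ^+ 2 by rewrite exprn_even_gt0 //= -unitfE -unitmxE.
rewrite -(pmulr_lge0 _ d0); have := pE' 0; rewrite -C0 => /(_ uC) <-.
apply: (horner0_ge0 e0) => t /Ct [ut it].
by rewrite pE' // mulr_ge0 // sqr_ge0.
Qed.

End Limit.

(** * Pencils in a real parameter *)

Section Pencil.
Variable R : realType.

(* Entrywise form of [l X - (X - B)], where [X] keeps the entries of [B]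
   selected by [x]. *)
Definition pencil (x : rel nat) n (B : 'M[R]_n) (l : R) : 'M[R]_n :=
  \matrix_(i, j) (B i j * l ^+ x i j).

Definition mask (x : rel nat) n (B : 'M[R]_n) : 'M[R]_n :=
  \matrix_(i, j) (if x i j then B i j else 0).

Lemma pencilD x n (B : 'M[R]_n) l t :
  pencil x B (l + t) = pencil x B l + t *: mask x B.
Proof. by apply/matrixP => i j; rewrite !mxE; case: x => /=; ring. Qed.

Lemma pencilE x n (B : 'M[R]_n) l :
  pencil x B l = l *: mask x B - (mask x B - B).
Proof. by apply/matrixP => i j; rewrite !mxE; case: x => /=; ring. Qed.

Lemma pencil1 x n (B : 'M[R]_n) : pencil x B 1 = B.
Proof. by apply/matrixP => i j; rewrite !mxE expr1n mulr1. Qed.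

Lemma Zmatrix_pencil x n (B : 'M[R]_n) l :
  Zmatrix B -> 0 <= l -> Zmatrix (pencil x B l).
Proof. by move=> ZB l0 i j /ZB Bij; rewrite mxE mulr_le0_ge0 // exprn_ge0. Qed.

Lemma Zmatrix_mask x n (B : 'M[R]_n) : Zmatrix B -> Zmatrix (mask x B).
Proof. by move=> ZB i j /ZB Bij; rewrite mxE; case: ifP. Qed.

Lemma mask_ge x n (B : 'M[R]_n) i j :
  reflexive x -> Zmatrix B -> B i j <= mask x B i j.
Proof.
move=> rx ZB; rewrite mxE; case: ifPn => //.
by have [->|/ZB//] := eqVneq i j; rewrite rx.
Qed.

(** The same vector works: [l *: (mask x B *m v)] is the positive [pencil x B l *m v] plus the image
    of [v] under the nonnegative [mask x B - B], so raising [l] only adds nonnegative terms. *)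
Lemma semipositive_pencil_up x n (B : 'M[R]_n) l l' :
  reflexive x -> Zmatrix B -> 0 < l -> l <= l' ->
  semipositive (pencil x B l) -> semipositive (pencil x B l').
Proof.
move=> rx ZB l0 ll [v v0 Cv]; exists v => // i.
have ->: l' = l + (l' - l) by lra.
rewrite pencilD mulmxDl -scalemxAl mxE [X in _ + X]mxE.
rewrite ltr_wpDr // mulr_ge0 ?subr_ge0 //.
have : 0 <= l * (mask x B *m v) i 0.
  have := Cv i; rewrite pencilE mulmxBl -scalemxAl mxE [X in _ < X + _]mxE.
  rewrite [X in _ + X]mxE subr_gt0 => H; apply: ltW; apply: le_lt_trans H.
  rewrite mxE sumr_ge0 // => j _; apply: mulr_ge0; last exact/ltW.
  by rewrite mxE [X in _ + X]mxE subr_ge0 mask_ge.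
by rewrite pmulr_rge0.
Qed.

(* The infimum of the [mu] with a semipositive pencil is attained, by the limit
   lemma, and can be lowered, semipositivity being open, unless it is [l]. *)
Lemma semipositive_pencil_down x n (B : 'M[R]_n) l :
  reflexive x -> Zmatrix B -> semipositive B -> 0 < l -> l <= 1 ->
  (forall mu, l <= mu -> mu < 1 -> pencil x B mu \in unitmx) ->
  semipositive (pencil x B l).
Proof.
move=> rx ZB sB l0 l1 uB.
pose E : set R := fun mu => l <= mu /\ semipositive (pencil x B mu).
have E1 : E 1 by split=> //; rewrite pencil1.
have lbE : lbound E l by move=> mu [].
have infE : has_inf E by split; [exists 1|exists l].
have hlE : has_lbound E by exists l.
pose mu := inf E.
have lmu : l <= mu by apply: lb_le_inf => //; exists 1.
have mu1 : mu <= 1 by apply: ge_inf.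
have mu0 : 0 < mu by apply: lt_le_trans lmu.
have smu t : 0 < t -> semipositive (pencil x B (mu + t)).
  move=> /(inf_adherent)/(_ infE)[e [le se] emu].
  by apply: semipositive_pencil_up se; rewrite ?(lt_le_trans l0 le) // ltW.
have Zmu t : 0 <= t -> Zmatrix (pencil x B t) by exact: Zmatrix_pencil.
have [v v0 Cv] : semipositive (pencil x B mu).
  (* Invertibility is assumed below 1 only; at 1 the pencil is [B] itself. *)
  have [mu1'|] := ltP mu 1; last first.
    move=> ge1; have -> : mu = 1 by apply/le_anti; rewrite mu1.
    by rewrite pencil1.
  apply: Zmatrix_inv_semipositive; [exact/Zmu/ltW|exact: uB|].
  apply: (@inv_ge0_lim _ _ _ (mask x B) 1); rewrite ?uB // => t /andP[t0 _].
  rewrite -pencilD; have st := smu t t0; have Zt := Zmu (mu + t).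
  have {}Zt := Zt (ltW (addr_gt0 mu0 t0)).
  by split; [apply: Zmatrix_unit|move=> i j; apply: Zmatrix_inv_ge0].
have [] := ltP l mu; last first.
  move=> mul; have -> : l = mu by apply/le_anti; rewrite lmu.
  by exists v.
move=> lmu'.
suff [d [d0 dl Cd]] : exists d, [/\ 0 < d, l <= mu - d &
    forall i, 0 < (pencil x B (mu - d) *m v) i 0].
  have : mu <= mu - d by apply: ge_inf => //; split=> //; exists v.
  by lra.
pose w i := (mask x B *m v) i 0; pose c i := (pencil x B mu *m v) i 0.
suff [d [d0 dl dw]] : exists d, [/\ 0 < d, d <= mu - l &
    forall i, d * w i < c i].
  exists d; split=> //; first by lra.
  move=> i; rewrite pencilD mulmxDl scaleNr mulNmx -scalemxAl.
  by rewrite mxE [X in _ + X]mxE [X in _ - X]mxE subr_gt0 dw.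
(* Adding 1 avoids division by zero and makes the bound strict; starting the minimum below at
   [mu - l] keeps [mu - d] at or above [l]. *)
pose d i := c i / (`|w i| + 1).
have w1 i : 0 < `|w i| + 1 by rewrite ltr_wpDl.
have d0 i : 0 < d i by rewrite divr_gt0 // Cv.
exists (\big[Num.min/mu - l]_i d i); split.
- by apply: lt_bigmin => [|i _]; rewrite ?subr_gt0.
- exact: bigmin_le_id.
move=> i; apply: (@le_lt_trans _ _ (d i * `|w i|)).
  apply: le_trans _ (ler_wpM2r (normr_ge0 _) (bigmin_le (mu - l) i _)).
  apply: ler_wpM2l (ler_norm _).
  by apply: le_bigmin => [|k _]; rewrite ?subr_ge0 // ltW.
rewrite /d mulrAC ltr_pdivrMr // ltr_pM2l ?Cv //; lra.
Qed.

End Pencil.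

(** * Diagonal scaling and moduli of eigenvalues *)

Section Comparison.
Variable R : realType.

(** Scaling row [i] by [l ^+ f i] and column [j] by [l ^- f j] turns the exponent [x i j] into
    [x i j + f i - f j]. As [l <= 1] and off-diagonal entries are nonpositive, a larger exponent
    means a larger entry, so the scaled [x] pencil dominates the [y] pencil. *)
Lemma semipositive_pencil_transfer (x y : rel nat) (f : nat -> nat) n
    (B : 'M[R]_n) l :
  reflexive x -> reflexive y -> Zmatrix B -> 0 < l -> l <= 1 ->
  (forall i j, i != j -> B i j != 0 -> (y i j + f j <= x i j + f i)%N) ->
  semipositive (pencil y B l) -> semipositive (pencil x B l).
Proof.
move=> rx ry ZB l0 l1 xy [v v0 Cv].
have lf k : 0 < l ^+ k by rewrite exprn_gt0.
exists (\col_j (v j 0 / l ^+ f j)) => i; first by rewrite mxE divr_gt0.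
apply: (@lt_le_trans _ _ ((pencil y B l *m v) i 0 / l ^+ f i)).
  by rewrite divr_gt0.
rewrite !mxE mulr_suml ler_sum // => j _; rewrite !mxE.
have [->|nij] := eqVneq i j; first by rewrite rx ry mulrA.
have [->|Bij] := eqVneq (B i j) 0; first by rewrite !mul0r.
rewrite -!mulrA; apply: ler_wnM2l; first exact: ZB.
rewrite mulrCA [X in _ <= X]mulrCA; apply: ler_wpM2l; first exact/ltW.
rewrite ler_pdivrMr // mulrAC ler_pdivlMr // -!exprD.
by apply: ler_wiXn2l; rewrite ?(ltW l0) ?xy.
Qed.

Lemma normc_sum (I : Type) (r : seq I) (P : pred I) (F : I -> R[i]) :
  Normc.normc (\sum_(i <- r | P i) F i) <=
  \sum_(i <- r | P i) Normc.normc (F i).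
Proof.
elim/big_rec2: _ => [|i a b _ ab]; first by rewrite Normc.normc0.
by apply: le_trans (le_normcD _ _) _; rewrite lerD2l.
Qed.

Lemma normc_real (a : R) : Normc.normc a%:C%C = `|a|.
Proof. by rewrite /= expr0n addr0 sqrtr_sqr. Qed.

Lemma normcX (z : R[i]) k : Normc.normc (z ^+ k) = Normc.normc z ^+ k.
Proof.
by elim: k => [|k IH]; rewrite ?expr0 ?Normc.normc1 // !exprS Normc.normcM IH.
Qed.

Lemma normc_ge0 (z : R[i]) : 0 <= Normc.normc z.
Proof. by case: z => a b; apply: sqrtr_ge0. Qed.

(* The vector of moduli of a kernel vector of the pencil at [z] is mapped to a
   nonpositive vector by the pencil at [|z|]. *)
Lemma pencil_kernel_lt x n (B : 'M[R]_n) l (z : R[i]) (w : 'cV[R[i]]_n) :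
  reflexive x -> Zmatrix B -> (forall i, 0 <= B i i) -> 0 < l ->
  semipositive (pencil x B l) -> w != 0 ->
  (forall i, \sum_j (B i j)%:C%C * z ^+ x i j * w j 0 = 0) ->
  Normc.normc z < l.
Proof.
move=> rx ZB B0 l0 sl w0 Bw; rewrite ltNge; apply/negP => lz.
have sz := semipositive_pencil_up rx ZB l0 lz sl.
have Zz := @Zmatrix_pencil _ x _ B _ ZB (normc_ge0 z).
(* The sign is chosen so that monotonicity yields [- |w i| >= 0], hence [w = 0]. *)
pose a : 'cV[R]_n := \col_i - Normc.normc (w i 0).
have a0 : forall i, 0 <= a i 0.
  apply: (Zmatrix_monotone Zz sz) => i.
  have nE j : Normc.normc ((B i j)%:C%C * z ^+ x i j * w j 0) =
      `|B i j| * Normc.normc z ^+ x i j * Normc.normc (w j 0).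
    by rewrite !Normc.normcM normc_real normcX.
  have /eqP := Bw i; rewrite (bigD1 i) //= addr_eq0.
  move=> /eqP/(congr1 (@Normc.normc _)).
  rewrite nE (@normcN R) => Ei.
  rewrite mxE (bigD1 i) //= !mxE mulrN addrC subr_ge0.
  rewrite -{1}(ger0_norm (B0 i)) Ei; apply: le_trans (normc_sum _ _ _) _.
  rewrite ler_sum // => j nji; rewrite nE !mxE mulrN -!mulNr.
  by rewrite ler0_norm // ZB // eq_sym.
case/eqP: w0; apply/colP => i; rewrite [RHS]mxE; apply: Normc.eq0_normc.
by apply/le_anti; rewrite normc_ge0 andbT -oppr_ge0; have := a0 i; rewrite mxE.
Qed.

End Comparison.

(** * From the iteration matrix to the pencil *)

Section Reduction.
Variable R : realType.
Local Notation toC := (real_complex R).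

Lemma widen_lift m (i : 'I_m) : widen_ord (leqnSn m) i = lift ord_max i.
Proof. exact/val_inj/esym/lift_max. Qed.

Lemma unlift_widen m (i : 'I_m) :
  unlift ord_max (widen_ord (leqnSn m) i) = Some i.
Proof. by rewrite widen_lift liftK. Qed.

Lemma ext1_widen m (B : 'M[R]_m) i (w : 'cV[R[i]]_m.+1) :
  (map_mx toC (ext1 B) *m w) (widen_ord (leqnSn m) i) 0 =
  \sum_j (B i j)%:C%C * w (widen_ord (leqnSn m) j) 0.
Proof.
rewrite mxE big_ord_recr /= !mxE unlift_widen unlift_none mul0r addr0.
by apply: eq_bigr => j _; rewrite !mxE !unlift_widen.
Qed.

Lemma ext1_max m (B : 'M[R]_m) (w : 'cV[R[i]]_m.+1) :
  (map_mx toC (ext1 B) *m w) ord_max 0 = w ord_max 0.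
Proof.
rewrite mxE big_ord_recr /= !mxE unlift_none mul1r big1 ?add0r // => j _.
by rewrite !mxE unlift_widen unlift_none mul0r.
Qed.

Lemma LmxA m (A : 'M[R]_m.+1) i j : (forall j, \sum_i A i j = 0) ->
  (Lmx m *m A) i j = if i == ord_max then 0 else A i j.
Proof.
move=> sA; rewrite mxE; have [->|ni] := eqVneq.
  by rewrite -[RHS](sA j); apply: eq_bigr => k _; rewrite mxE eqxx orbT mul1r.
rewrite (bigD1 i) //= mxE eqxx mul1r big1 ?addr0 // => k nk.
by rewrite mxE eq_sym (negPf nk) (negPf ni) mul0r.
Qed.

Lemma Lmx_unit m : (Lmx m : 'M[R]_m.+1) \in unitmx.
Proof.
rewrite unitmxE det_trig.
  by rewrite big1 ?unitr1 // => i _; rewrite mxE eqxx.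
apply/is_trig_mxP => i j ij; rewrite mxE -val_eqE /= (ltn_eqF ij) /=.
by case: eqP => // im; move: ij; rewrite im /= ltnNge -ltnS ltn_ord.
Qed.

Lemma ext1_unit m (B : 'M[R]_m) : B \in unitmx -> ext1 B \in unitmx.
Proof.
move=> uB; rewrite -(map_unitmx toC); apply: unitmx_col => w Ew.
have wm : w ord_max 0 = 0 by rewrite -(ext1_max B) Ew mxE.
have w0 : \col_j w (widen_ord (leqnSn m) j) 0 = 0.
  rewrite -[LHS](@mulKmx _ _ _ (map_mx toC B)) ?map_unitmx //.
  rewrite [X in _ *m X](_ : _ = 0) ?mulmx0 //; apply/colP => i.
  transitivity ((map_mx toC (ext1 B) *m w) (widen_ord (leqnSn m) i) 0).
    by rewrite ext1_widen mxE; apply: eq_bigr => j _; rewrite !mxE.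
  by rewrite Ew !mxE.
apply/colP => k; rewrite [RHS]mxE; case: (unliftP ord_max k) => [j|] -> //.
by have /colP/(_ j) := w0; rewrite !mxE => <-; rewrite widen_lift.
Qed.

Lemma ext1_iter m (X : 'M[R]_m -> 'M[R]_m) (A : 'M[R]_m.+1) :
  ext1 (X (lead_sub A)) \in unitmx ->
  ext1 (X (lead_sub A)) *m iter_mx X A = ext1 (X (lead_sub A)) - Lmx m *m A.
Proof.
move=> uE; have uM : Mprime X A \in unitmx.
  by rewrite unitmx_mul unitmx_inv Lmx_unit.
have LM : Lmx m *m Mprime X A = ext1 (X (lead_sub A)).
  by rewrite /Mprime mulKVmx ?Lmx_unit.
by rewrite -{1}LM -mulmxA /iter_mx mulKVmx // mulmxBr LM.
Qed.

Lemma mem_spectrum n (P : 'M[R]_n) z :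
  (z \in spectrum_seq P) = root (char_poly (map_mx toC P)) z.
Proof.
rewrite /spectrum_seq; case: closed_field_poly_normal => s /= ->.
by rewrite (monicP (char_poly_monic _)) scale1r root_prod_XsubC.
Qed.

(** Multiplied by [E = ext1 (mask x B)], the eigenvector equation becomes [(E - L A) w = z E w]. Its
    last row says that the last entry of [w] equals [z] times itself, so that entry is 0 as
    [z != 1]; the other rows say that the pencil at [z] kills the rest of [w]. *)
Lemma spectrum_iterP m (x : rel nat) (A : 'M[R]_m.+1) z :
  (forall j, \sum_i A i j = 0) -> mask x (lead_sub A) \in unitmx -> z != 1 ->
  (z \in spectrum_seq (iter_mx (@mask R x m) A)) <->
  (exists2 w : 'cV[R[i]]_m, w != 0 &
    forall i, \sum_j (lead_sub A i j)%:C%C * z ^+ x i j * w j 0 = 0).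
Proof.
move=> sA uX z1; rewrite mem_spectrum; set B := lead_sub A.
have uE := ext1_unit uX; have := ext1_iter uE; rewrite -/B in uX uE *.
set E := ext1 _ => EP; set P := iter_mx _ _ in EP *.
have LAw i (w : 'cV[R[i]]_m.+1) : w ord_max 0 = 0 ->
    (map_mx toC (Lmx m *m A) *m w) (widen_ord (leqnSn m) i) 0 =
    \sum_j (B i j)%:C%C * w (widen_ord (leqnSn m) j) 0.
  move=> wm; rewrite mxE big_ord_recr /= wm mulr0 addr0.
  apply: eq_bigr => j _; rewrite mxE LmxA // -val_eqE /= ltn_eqF ?ltn_ord //.
  by rewrite mxE.
have LAm (w : 'cV[R[i]]_m.+1) : (map_mx toC (Lmx m *m A) *m w) ord_max 0 = 0.
  by rewrite mxE big1 // => j _; rewrite mxE LmxA // eqxx mul0r.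
have rowE i (w : 'cV[R[i]]_m.+1) : w ord_max 0 = 0 ->
    (z *: (map_mx toC E *m w) - map_mx toC (E - Lmx m *m A) *m w)
      (widen_ord (leqnSn m) i) 0 =
    \sum_j (B i j)%:C%C * z ^+ x i j * w (widen_ord (leqnSn m) j) 0.
  move=> wm; rewrite map_mxB mulmxBl.
  rewrite mxE [X in X + _]mxE [X in _ + X]mxE [X in - X]mxE [X in - (_ + X)]mxE.
  rewrite LAw // !ext1_widen mulr_sumr -!sumrB; apply: eq_bigr => j _.
  by rewrite mxE; case: (x i j) => /=; ring.
split.
  move/eigenvalue_colP => [w Pw w0].
  have Ew : map_mx toC (E - Lmx m *m A) *m w = z *: (map_mx toC E *m w).
    by rewrite -EP map_mxM -mulmxA Pw scalemxAr.
  have wm : w ord_max 0 = 0.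
    have /colP/(_ ord_max) := Ew; rewrite map_mxB mulmxBl.
    rewrite mxE [X in _ + X]mxE LAm subr0 ext1_max [RHS]mxE ext1_max => h.
    have /eqP : (1 - z) * w ord_max 0 = 0 by rewrite mulrBl mul1r {1}h subrr.
    by rewrite mulf_eq0 subr_eq0 eq_sym (negPf z1) => /eqP.
  exists (\col_j w (widen_ord (leqnSn m) j) 0); last first.
    move=> i; transitivity ((0 : 'cV[R[i]]_m.+1) (widen_ord (leqnSn m) i) 0).
      by rewrite -(subrr (z *: (map_mx toC E *m w))) -{2}Ew rowE //;
        apply: eq_bigr => j _; rewrite [X in _ * X = _]mxE.
    by rewrite mxE.
  apply: contra w0 => /eqP/colP w'0; apply/eqP/colP => k; rewrite [RHS]mxE.
  case: (unliftP ord_max k) => [j|] -> //.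
  by have := w'0 j; rewrite !mxE => <-; rewrite widen_lift.
case=> w w0 Bw; apply/eigenvalue_colP.
pose u : 'cV[R[i]]_m.+1 :=
  \col_k if unlift ord_max k is Some j then w j 0 else 0.
have um : u ord_max 0 = 0 by rewrite mxE unlift_none.
have uw j : u (widen_ord (leqnSn m) j) 0 = w j 0 by rewrite mxE unlift_widen.
exists u; last first.
  apply: contra w0 => /eqP u0; apply/eqP/colP => j.
  by rewrite -uw u0 !mxE.
have uEC : map_mx toC E \in unitmx by rewrite map_unitmx.
rewrite -[LHS](mulKmx uEC) -[RHS](mulKmx uEC); congr (_ *m _).
rewrite mulmxA -map_mxM EP; apply/esym/eqP; rewrite -scalemxAr -subr_eq0.
apply/eqP/colP => k.
rewrite [RHS]mxE; case: (unliftP ord_max k) => [j|] ->.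
  by rewrite -widen_lift rowE // -[RHS](Bw j); apply: eq_bigr => i _; rewrite uw.
rewrite map_mxB mulmxBl mxE [X in X + _]mxE [X in _ + X]mxE [X in - X]mxE.
by rewrite [X in - (_ + X)]mxE LAm ext1_max um mulr0 !subr0.
Qed.

End Reduction.

(** * Left null vectors of irreducible matrices *)

Section Irreducible.
Variable R : realType.

(* The indices where [|w|] is maximal are closed under predecessors in the graph
   of [A], so by irreducibility [k0] would be one of them if [w] were nonzero. *)
Lemma irreducible_left_kernel n (A : 'M[R]_n) (k0 : 'I_n) (w : 'I_n -> R) :
  Zmatrix A -> (forall j, \sum_i A i j = 0) -> irreducible_mx A ->
  w k0 = 0 -> (forall l, l != k0 -> \sum_k A k l * w k = 0) ->
  forall k, w k = 0.
Proof.
move=> ZA sA irr wk0 Aw k.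
case: (@arg_maxP _ _ _ k0 predT (fun i => `|w i|)) => // i _ imax0.
have imax j : `|w j| <= `|w i| by exact: imax0.
have [wi0|wi0] := eqVneq (w i) 0.
  apply/normr0_eq0/le_anti.
  by rewrite normr_ge0 andbT (le_trans (imax k)) // wi0 normr0.
have A0 l : 0 <= A l l.
  have /eqP := sA l; rewrite (bigD1 l) //= addr_eq0 => /eqP ->.
  by rewrite oppr_ge0 sumr_le0 // => j; apply: ZA.
have step j l : A j l != 0 -> `|w l| = `|w i| -> `|w j| = `|w i|.
  move=> Ajl wl; have [->//|njl] := eqVneq j l.
  have lk0 : l != k0.
    by apply: contra_neq wi0 => lk; apply/normr0_eq0; rewrite -wl lk wk0 normr0.
  (* Taking moduli in the kernel equation of column [l] and using its zero column sum bounds this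
     sum of nonnegative terms by 0, so each term vanishes. *)
  have sum_le0 : \sum_(k | k != l) - A k l * (`|w i| - `|w k|) <= 0.
    have El : A l l * `|w i| <= \sum_(k | k != l) - A k l * `|w k|.
      have /eqP := Aw l lk0; rewrite (bigD1 l) //= addr_eq0 => /eqP.
      move=> /(congr1 Num.norm); rewrite normrM normrN wl (ger0_norm (A0 l)) => ->.
      apply: le_trans (ler_norm_sum _ _ _) _; apply: ler_sum => q nq.
      by rewrite normrM ler0_norm // ZA.
    have /eqP := sA l; rewrite (bigD1 l) //= addr_eq0 => /eqP sAl.
    under eq_bigr do rewrite mulrBr.
    by rewrite sumrB -mulr_suml sumrN -sAl subr_le0.
  have ge0 q : q != l -> 0 <= - A q l * (`|w i| - `|w q|).
    by move=> ql; rewrite mulr_ge0 ?oppr_ge0 ?ZA // subr_ge0 imax.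
  have /psumr_eq0P/(_ j njl)/eqP :
      \sum_(k | k != l) - A k l * (`|w i| - `|w k|) = 0.
    by apply/le_anti; rewrite sum_le0 sumr_ge0.
  by move=> /(_ ge0); rewrite mulf_eq0 oppr_eq0 (negPf Ajl) subr_eq0 => /eqP.
have back p k1 : path (fun k l => A k l != 0) k1 p ->
    `|w (last k1 p)| = `|w i| -> `|w k1| = `|w i|.
  elim: p k1 => //= j p IH k1 /andP[Akj pp] /(IH _ pp).
  exact: step.
have /connectP[p pp pi] := irr k0 i.
have := back p k0 pp; rewrite -pi wk0 normr0 => /(_ erefl)/esym/eqP.
by rewrite normr_eq0 (negPf wi0).
Qed.

End Irreducible.

(** * Comparing two splittings *)

Section Gamma.
Variable R : realType.

(** Suppose an eigenvalue [z != 1] of the [x] iteration has modulus above the [gamma] of the [y]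
    iteration. No real [mu] in [[|z|, 1)] is then an eigenvalue of the latter, so the [y] pencil
    stays semipositive down to [|z|]. By scaling so does the [x] pencil, which forces
    [|z| < |z|]. *)
Lemma gamma_iter_le (x y : rel nat) (f : nat -> nat) m (A : 'M[R]_m.+1) :
  let B := lead_sub A in
  reflexive x -> reflexive y -> Zmatrix B -> (forall i, 0 <= B i i) ->
  semipositive B -> (forall j, \sum_i A i j = 0) ->
  (forall i j, i != j -> B i j != 0 -> (y i j + f j <= x i j + f i)%N) ->
  gamma (iter_mx (@mask R x m) A) <= gamma (iter_mx (@mask R y m) A).
Proof.
move=> B rx ry ZB B0 sB sA xy.
have umask r : reflexive r -> mask r B \in unitmx.
  move=> rr; apply: Zmatrix_unit; first exact: Zmatrix_mask.
  by apply: semipositive_le sB => i j; apply: mask_ge.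
rewrite {1}/gamma big_seq_cond.
apply: bigmax_le => [|z /andP[zP z1]]; first exact: bigmax_ge_id.
have /(spectrum_iterP sA (umask x rx) z1)[w w0 Bw] := zP.
have lt1 : Normc.normc z < 1.
  by apply: (pencil_kernel_lt rx ZB B0 _ _ w0 Bw); rewrite ?pencil1.
rewrite leNgt; apply/negP => gz.
(* The maximum defining [gamma] starts from 0, so [|z|] is positive, as the scaling by its powers
   demands. *)
have l0 : 0 < Normc.normc z by apply: le_lt_trans gz; apply: bigmax_ge_id.
suff sl : semipositive (pencil x B (Normc.normc z)).
  by have := pencil_kernel_lt rx ZB B0 l0 sl w0 Bw; rewrite ltxx.
apply: (semipositive_pencil_transfer rx ry ZB l0 (ltW lt1) xy).
apply: semipositive_pencil_down => // [|mu zmu mu1]; first exact: ltW.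
rewrite -(map_unitmx (real_complex R)); apply: unitmx_col => u Bu.
apply/eqP; apply: contraLR zmu => u0; rewrite -ltNge.
have muC : mu%:C%C != 1.
  by rewrite (_ : 1 = 1%:C%C) // (inj_eq (@complexI R)) lt_eqF.
have muP : mu%:C%C \in spectrum_seq (iter_mx (@mask R y m) A).
  apply/(spectrum_iterP sA (umask y ry) muC); exists u => // i.
  transitivity ((map_mx (real_complex R) (pencil y B mu) *m u) i 0).
    rewrite mxE; apply: eq_bigr => j _.
    by rewrite [X in _ = X * _]mxE [pencil _ _ _ _ _]mxE rmorphM rmorphXn.
  by rewrite Bu mxE.
apply: le_lt_trans gz; apply: le_trans (ler_norm mu) _; rewrite -normc_real.
exact: (le_bigmax_seq _ _ (fun z => z != 1)).
Qed.

End Gamma.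

(** * The leading submatrix and the four splittings *)

Section Hessenberg.
Variable R : realType.

(** Irreducibility gives invertibility. For the sign of the inverse, [B] is approached by [B + t I],
    whose positive column sums make its transpose semipositive on the all-ones vector. *)
Lemma lead_sub_semipositive m (A : 'M[R]_m.+1) :
  Zmatrix A -> (forall j, \sum_i A i j = 0) -> irreducible_mx A ->
  semipositive (lead_sub A).
Proof.
move=> ZA sA irr; set B := lead_sub A.
have ZB : Zmatrix B by move=> i j nij; rewrite mxE ZA // -val_eqE.
have uB : B \in unitmx.
  rewrite -unitmx_tr; apply: unitmx_col => y By.
  (* Padding a left null vector of [B] by 0 at the last index preserves the null equations of all
     columns but the last. *)
  pose w k := if unlift ord_max k is Some j then y j 0 else 0.
  have ww j : w (widen_ord (leqnSn m) j) = y j 0 by rewrite /w unlift_widen.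
  apply/colP => j; rewrite [RHS]mxE -ww.
  apply: (irreducible_left_kernel ZA sA irr (k0 := ord_max)).
    by rewrite /w unlift_none.
  move=> l; case: (unliftP ord_max l) => [i -> _|->]; last by rewrite eqxx.
  rewrite big_ord_recr /= [w ord_max]/w unlift_none mulr0 addr0.
  transitivity ((B^T *m y) i 0); last by rewrite By mxE.
  by rewrite mxE; apply: eq_bigr => k _; rewrite !mxE ww -widen_lift.
apply: Zmatrix_inv_semipositive => //.
apply: (@inv_ge0_lim _ _ _ 1%:M 1) => // t /andP[t0 _].
have ZBt : Zmatrix (B + t *: 1%:M)^T.
  move=> i j nij; rewrite !mxE eq_sym (negPf nij) mulr0 addr0 ZA //.
  by rewrite -val_eqE eq_sym.
have sBt : semipositive (B + t *: 1%:M)^T.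
  exists (const_mx 1) => [i|i]; rewrite mxE ?ltr01 //.
  have -> : \sum_j (B + t *: 1%:M)^T i j * (const_mx 1 : 'cV_m) j 0 =
      t - A ord_max (widen_ord (leqnSn m) i).
    have := sA (widen_ord (leqnSn m) i); rewrite big_ord_recr /= => /eqP.
    rewrite addr_eq0 => /eqP <-.
    rewrite (eq_bigr (fun j => A (widen_ord (leqnSn m) j) (widen_ord (leqnSn m) i)
                             + (if j == i then t else 0))) => [|j _].
      by rewrite big_split /= -big_mkcond big_pred1_eq addrC.
    by rewrite !mxE mulr1 mulr_natr mulrb.
  rewrite subr_gt0; apply: le_lt_trans t0; apply: ZA.
  by rewrite -val_eqE /= gtn_eqF.
split=> [|i j]; first by rewrite -unitmx_tr Zmatrix_unit.
have := Zmatrix_inv_ge0 j i ZBt sBt.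
by rewrite -trmx_inv mxE.
Qed.

Lemma diag_partE m : @diag_part R m = @mask R (fun i j => i == j) m.
Proof. by apply/funext => B; apply/matrixP => i j; rewrite !mxE. Qed.

Lemma tril_partE m : @tril_part R m = @mask R (fun i j => (j <= i)%N) m.
Proof. by apply/funext => B; apply/matrixP => i j; rewrite !mxE. Qed.

Lemma triu_partE m : @triu_part R m = @mask R leq m.
Proof. by apply/funext => B; apply/matrixP => i j; rewrite !mxE. Qed.

Definition stair_rel (b : bool) (i j : nat) :=
  (i == j) || ((odd i == b) && ((j == i.+1) || (i == j.+1))).

Lemma stairE b m : @stair R b m = @mask R (stair_rel b) m.
Proof.
apply/funext => B; apply/matrixP => i j; rewrite !mxE /stair_rel.
by rewrite (inj_eq val_inj); case: eqVneq.
Qed.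

End Hessenberg.

Theorem theorem6 (R : realType) (m : nat) (A T : 'M[R]_m.+1) (first : bool) :
  irreducible_mx A ->
  M_matrix A ->
  \det A = 0 ->
  lower_hessenberg A ->
  column_stochastic T ->
  A = 1%:M - T ->
  gamma (iter_mx (@diag_part R m) A) >= gamma (iter_mx (@tril_part R m) A) /\
  gamma (iter_mx (@tril_part R m) A) >= gamma (iter_mx (@stair R first m) A) /\
  gamma (iter_mx (@stair R first m) A) >= gamma (iter_mx (@triu_part R m) A).
Proof.
move=> irr _ _ hess [T0 sT] AT.
have ZA : Zmatrix A.
  by move=> i j nij; rewrite AT !mxE (negPf nij) sub0r oppr_le0.
have A0 i : 0 <= A i i.
  rewrite AT !mxE eqxx subr_ge0 -(sT i) (bigD1 i) //= lerDl sumr_ge0 //.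
have sA j : \sum_i A i j = 0.
  rewrite AT; under eq_bigr do rewrite !mxE.
  by rewrite sumrB sT (bigD1 j) //= eqxx big1 ?addr0 ?subrr // => i /negPf ->.
have sB := lead_sub_semipositive ZA sA irr.
have ZB : Zmatrix (lead_sub A) by move=> i j nij; rewrite mxE ZA // -val_eqE.
have B0 i : 0 <= lead_sub A i i by rewrite mxE.
have hB i j : lead_sub A i j != 0 -> (j <= i.+1)%N.
  by rewrite leqNgt mxE; apply: contra_neqN => ij; apply: hess.
(* By the Hessenberg form, [j = i + 1] is the only case above the diagonal, so an [f] growing by at
   most one per step can suffice. *)
have le_of x y f : reflexive x -> reflexive y ->
    (forall i j : nat, i != j -> (j <= i.+1)%N ->
      (y i j + f j <= x i j + f i)%N) ->
    gamma (iter_mx (@mask R x m) A) <= gamma (iter_mx (@mask R y m) A).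
  by move=> rx ry xy; apply: gamma_iter_le rx ry ZB B0 sB sA _ => i j nij /hB;
    apply: xy; rewrite val_eqE.
rewrite diag_partE tril_partE triu_partE stairE.
have rS : reflexive (stair_rel first) by move=> i; rewrite /stair_rel eqxx.
split; last split.
- by apply: (le_of _ _ (fun=> 0%N)) => [i|i|i j]; rewrite ?leqnn ?eqxx //; lia.
(* [f] counts the rows below [j] that keep off-diagonal entries. *)
- apply: (le_of _ _ (fun j => (j + ~~ first)./2)) => // i j.
  by rewrite /stair_rel; case: (first) => /=; lia.
(* [f] counts the rows below [j] reduced to their diagonal entry. *)
apply: (le_of _ _ (fun j => (j + first)./2)) => // i j.
by rewrite /stair_rel; case: (first) => /=; lia.
Qed.
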